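(* Let $G=(V,E,\omega,\mu)$ be an infinite, locally finite, connected weighted graph with $\omega_{\min}>0$, let $p>1$, and let $\psi:V\to[0,\infty)$ be bounded and not identically zero. For $\lambda>0$ let $T_\lambda$ be the life span of the solution of $u_t=\Delta u+u^p$ on $V$ with $u(x,0)=\lambda\psi(x)$. If $D_\mu<+\infty$, then there exists $\Lambda>0$ such that $T_\lambda<\infty$ whenever $\lambda>\Lambda$, and $$\lim_{\lambda\to\infty}\lambda^{p-1}T_\lambda=\frac{1}{(p-1)\|\psi\|_{\ell^\infty(V)}^{p-1}}.$$
   Context: Weighted graph: $V$ is the vertex set, $E$ the edge set, $y\sim x$ means $xy\in E$; $\omega:V\times V\to[0,\infty)$ satisfies $\omega_{xy}=\omega_{yx}$ and $\omega_{xy}>0$ iff $x\sim y$; $\mu:V\to(0,\infty)$. Locally finite means every vertex has finitely many neighbours. Graphs have no loops and no multiple edges. $\omega_{\min}=\inf_{x\sim y}\omega_{xy}$, and $$\Delta u(x)=\frac1{\mu(x)}\sum_{y\sim x}\omega_{xy}(u(y)-u(x)),\qquad D_\mu=\sup_{x\in V}\frac{1}{\mu(x)}\sum_{y\sim x}\omega_{xy},\qquad \|\psi\|_{\ell^\infty(V)}=\sup_{x\in V}|\psi(x)|.$$ Solution: a solution in $[0,T)$ of the problem $u_t=\Delta u+u^p$ in $V\times(0,T)$, $u(x,0)=\lambda\psi(x)$ on $V$, is a function $u:V\times[0,T)\to[0,\infty)$ satisfying the problem such that for each $x\in V$ the function $u(x,\cdot)$ is continuous on $[0,T)$ and $C^1$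 on $(0,T)$, and such that $u$ is bounded on $V\times[0,T']$ for every $0<T'<T$. (A unique local solution exists.) The life span is $T_\lambda=\sup\{T>0:\ \text{the problem has a solution in }[0,T)\}\in(0,\infty]$. *)

(* Defs.v *)
From HB Require Import structures.
From mathcomp Require Import all_boot all_order all_algebra.
From mathcomp Require Import all_classical all_reals all_analysis.

Set Implicit Arguments.
Unset Strict Implicit.
Unset Printing Implicit Defensive.

Import Order.TTheory GRing.Theory Num.Theory.
Import numFieldNormedType.Exports.

Local Open Scope classical_set_scope.
Local Open Scope ring_scope.

Record weighted_graph (R : realType) (V : choiceType) := WeightedGraph {
  edge : rel V;
  edge_sym : symmetric edge;
  edge_irr : irreflexive edge;
  weight : V -> V -> R;
  weight_ge0 : forall x y, 0 <= weight x y;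
  weight_sym : forall x y, weight x y = weight y x;
  weight_gt0 : forall x y, (0 < weight x y) = edge x y;
  mass : V -> R;
  mass_gt0 : forall x, 0 < mass x
}.

Section WeightedGraph.
Context {R : realType} {V : choiceType}.
Variable G : weighted_graph R V.

Definition neighbours (x : V) : set V := [set y | edge G x y].

Definition locally_finite : Prop := forall x, finite_set (neighbours x).

Definition connected_graph : Prop :=
  forall x y, exists2 s : seq V, path (edge G) x s & last x s = y.

Definition omega_min : \bar R :=
  ereal_inf [set (weight G e.1 e.2)%:E | e in [set e : V * V | edge G e.1 e.2]].

(* The sums below have the intended value only on locally finite graphs:
   [\sum_(y \in A)] is 0 when the summand has infinite support in [A]. *)
Definition laplacian (f : V -> R) (x : V) : R :=
  (mass G x)^-1 * \sum_(y \in neighbours x) weight G x y * (f y - f x).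

Definition Dmu : \bar R :=
  ereal_sup [set ((mass G x)^-1 * \sum_(y \in neighbours x) weight G x y)%:E
            | x in [set: V]].

(* The values of [u x] outside [0, T[ are irrelevant: the derivatives are only
   taken at interior points, and continuity at 0 is relative to [0, T[. *)
Record is_solution (p : R) (u0 : V -> R) (T : R) (u : V -> R -> R) : Prop := {
  sol_ge0 : forall x (t : R), 0 <= t < T -> 0 <= u x t;
  sol_continuous : forall x, {within `[0, T[, continuous (u x)};
  sol_derivable : forall x (t : R), 0 < t < T -> derivable (u x) t 1;
  sol_C1 : forall x (t : R), 0 < t < T -> {for t, continuous (derive1 (u x))};
  sol_eq : forall x (t : R), 0 < t < T ->
    derive1 (u x) t = laplacian (u ^~ t) x + u x t `^ p;
  sol_init : forall x, u x 0 = u0 x;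
  sol_bounded : forall T' : R, 0 < T' < T ->
    exists M : R, forall x (t : R), 0 <= t <= T' -> `|u x t| <= M
}.

Definition life_span (p : R) (u0 : V -> R) : \bar R :=
  ereal_sup [set T%:E | T in [set T : R |
    0 < T /\ exists u : V -> R -> R, is_solution p u0 T u]].

End WeightedGraph.

(* For unbounded [f] this real supremum is a default value. *)
Definition linfty_norm {R : realType} {V : choiceType} (f : V -> R) : R :=
  sup [set `|f x| | x in [set: V]].

(* Main.v *)
Require Import Defs.
From HB Require Import structures.
From mathcomp Require Import all_boot all_order all_algebra.
From mathcomp Require Import all_classical all_reals all_analysis.
From mathcomp Require Import ring lra.

Set Implicit Arguments.
Unset Strict Implicit.
Unset Printing Implicit Defensive.

Import Order.TTheory GRing.Theory Num.Theory.
Import numFieldNormedType.Exports.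

Local Open Scope classical_set_scope.
Local Open Scope ring_scope.

(** Upper bound: at a fixed vertex x the Laplacian is at least [- degree x * u x], so
    u_x' >= u_x^p - D u_x with D = degree x + 1.  Then
    (1 - D u_x^(1-p)) e^{-(p-1) D t} is nondecreasing, which bounds the life span
    by w / ((p-1)(1 - D w)) with w = (lambda psi x)^(1-p).  Multiplying by
    lambda^(p-1) and letting lambda tend to infinity gives
    psi(x)^(1-p)/(p-1), and x may be chosen with psi x close to the supremum.

    Lower bound: with N = lambda * sup psi, the spatially constant solution of
    z' = z^p, z 0 = N, is a supersolution on [0, N^(1-p)/(p-1)[.  The Picard
    iterates of the variation-of-constants formula starting from 0 increase and
    stay below z; by dominated convergence their limit is a fixed point, hence a
    solution.  So lambda^(p-1) T_lambda is at least the limit value for every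
    lambda > 0. *)

(** * Calculus preliminaries: products, exponentials and powers *)

Lemma within_continuousM (R : realType) (A : set R) (f g : R -> R) :
  {within A, continuous f} -> {within A, continuous g} ->
  {within A, continuous (fun t => f t * g t)}.
Proof. by move=> cf cg x; apply: cvgM; [exact: cf|exact: cg]. Qed.

Lemma continuous_expRM (R : realType) (c : R) : continuous (fun t => expR (c * t)).
Proof.
by move=> t; apply: continuous_comp; [exact: mulrl_continuous|exact: continuous_expR].
Qed.

Lemma is_derive_expRM (R : realType) (c t : R) :
  is_derive t 1 (fun s => expR (c * s)) (c * expR (c * t)).
Proof.
have H := is_deriveZ c (is_derive_id t (1 : R)).
have := is_derive1_comp (is_derive_expR (c * t)) H.
by rewrite mulrC /GRing.scale/= mulr1.
Qed.

Lemma powR_continuous_gt0 (R : realType) (q y : R) : 0 < y ->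
  {for y, continuous (fun z => z `^ q)}.
Proof.
move=> y0; apply/differentiable_continuous/derivable1_diffP/derivable_powR.
by rewrite in_itv/= y0.
Qed.

(** * Finite-time blow-up for a scalar differential inequality *)

Section blowup.
Context {R : realType}.
Variables (f : R -> R) (T D p : R).
Hypotheses (D0 : 0 < D) (p1 : 1 < p).
Hypothesis fc : {within `[0, T[, continuous f}.
Hypothesis fd : forall t : R, 0 < t < T -> derivable f t 1.
Hypothesis f'ge : forall t : R, 0 < t < T -> f t `^ p - D * f t <= derive1 f t.
Hypothesis f0 : 0 < f 0.

(** Since [powR] is nonnegative whatever the sign of its base, f' >= - D f. Hence f(s) e^(D s) is
    nondecreasing and stays above its positive initial value. *)
Lemma supersolution_gt0 (t : R) : 0 <= t < T -> 0 < f t.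
Proof.
move=> tT; move: (tT) => /andP[t0 ltT].
pose g s := f s * expR (D * s).
have g' s : s \in `]0, T[ ->
    is_derive s 1 g (f s * (D * expR (D * s)) + expR (D * s) * derive1 f s).
  rewrite in_itv => sT; have := fd sT => /derivableP; rewrite -derive1E => fs.
  exact: (is_deriveM fs (is_derive_expRM D s)).
have : g 0 <= g t.
  apply: (@ger0_derive1_le_co _ g 0 T) => //.
  - by move=> s /g' [].
  - move=> s sT; have [_ gs] := g' s sT; rewrite derive1E gs.
    move: sT; rewrite in_itv => sT.
    rewrite (_ : _ + _ = expR (D * s) * (D * f s + derive1 f s)); last by ring.
    rewrite mulr_ge0 ?expR_ge0//.
    have := f'ge sT; have := powR_ge0 (f s) p; lra.
  - apply: within_continuousM => //.
    by apply: continuous_subspaceT; exact: continuous_expRM.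
  - by rewrite in_itv/= lexx (le_lt_trans t0).
rewrite /g mulr0 expR0 mulr1 => /(lt_le_trans f0).
by rewrite pmulr_lgt0// expR_gt0.
Qed.

(** In the variable y = f^(1-p) the inequality becomes linear, y' <= (p-1)(D y - 1). An integrating
    factor solves it, and the positivity of y limits the time available. *)
Lemma blowup_time : D * f 0 `^ (1 - p) < 1 ->
  T <= f 0 `^ (1 - p) / ((p - 1) * (1 - D * f 0 `^ (1 - p))).
Proof.
set w0 := f 0 `^ (1 - p) => f0D.
(* With this rate, g' >= 0 is exactly the differential inequality divided by f^p. *)
pose c := (p - 1) * D.
have c0 : 0 < c by rewrite mulr_gt0// subr_gt0.
pose g s := (1 - D * f s `^ (1 - p)) * expR (- c * s).
have g' s : s \in `]0, T[ ->
    is_derive s 1 g ((1 - D * f s `^ (1 - p)) * (- c * expR (- c * s))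
     + expR (- c * s) * (0 - D * ((1 - p) * f s `^ (- p) * derive1 f s))).
  rewrite in_itv/= => sT; have := fd sT => /derivableP; rewrite -derive1E => fs.
  have fs0 : 0 < f s.
    by apply: supersolution_gt0; case/andP: sT => /ltW -> ->.
  have := is_derive1_powR (1 - p) fs0.
  have -> : 1 - p - 1 = - p by lra.
  move=> H'; have H := is_derive1_comp H' fs.
  have H2 := is_deriveZ D H.
  have H3 := is_deriveB (is_derive_cst (1 : R) s 1) H2.
  exact: (is_deriveM H3 (is_derive_expRM (- c) s)).
have gnd t : 0 <= t < T -> g 0 <= g t.
  move=> /andP[t0 tT].
  apply: (@ger0_derive1_le_co _ g 0 T) => //.
  - by move=> s /g' [].
  - move=> s sT; have [_ gs] := g' s sT; rewrite derive1E gs.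
    move: sT; rewrite in_itv/= => sT.
    have fs0 : 0 < f s.
      by apply: supersolution_gt0; case/andP: sT => /ltW -> ->.
    rewrite (_ : _ + _ = expR (- c * s) *
      (c * (f s `^ (- p) * derive1 f s - (1 - D * f s `^ (1 - p)))));
      last first.
      by rewrite /c; ring.
    rewrite mulr_ge0 ?expR_ge0// mulr_ge0 ?(ltW c0)// subr_ge0.
    have -> : 1 - D * f s `^ (1 - p) = f s `^ (- p) * (f s `^ p - D * f s).
      have pD r q : f s `^ (r + q) = f s `^ r * f s `^ q.
        by rewrite powRD// (gt_eqF fs0) implybT.
      rewrite mulrBr -pD addNr powRr0 pD.
      by rewrite powRr1 ?ltW//; ring.
    by rewrite ler_wpM2l ?powR_ge0// f'ge.
  - apply: within_continuousM; last first.
      by apply: continuous_subspaceT; exact: continuous_expRM.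
    apply: (@within_continuous_comp _ _ _ `[0, T[ f (fun y => 1 - D * y `^ (1 - p))) => //.
    move=> y /[!inE] -[s]; rewrite /= in_itv/= => sT <-.
    apply: cvgB; first exact: cvg_cst.
    by apply: cvgMr; apply: powR_continuous_gt0; exact: supersolution_gt0.
  - by rewrite in_itv/= lexx (le_lt_trans t0).
  - by rewrite in_itv/= t0.
rewrite leNgt; apply/negP => ltT.
(* At the claimed bound [t], 1 + c t equals 1 / (1 - D w0) exactly. So e^(c t) >= 1 + c t
   contradicts the strict estimate obtained below if [t] lies in the time interval. *)
set t := (w0 / _) in ltT.
have wD : 0 < 1 - D * w0 by rewrite subr_gt0.
have w00 : 0 < w0 by rewrite powR_gt0.
have t0 : 0 < t by rewrite divr_gt0// mulr_gt0// subr_gt0.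
have /gnd : 0 <= t < T by rewrite ltW.
rewrite /g mulr0 expR0 mulr1 -/w0.
have ftw : 0 < f t `^ (1 - p) by rewrite powR_gt0// supersolution_gt0// ltW.
move=> h.
(* Strict because D f(t)^(1-p) is positive. *)
have : 1 - D * w0 < expR (- c * t).
  apply: (le_lt_trans h); rewrite gtr_pMl ?expR_gt0//.
  by rewrite ltrBlDl ltrDr mulr_gt0.
apply/negP; rewrite -leNgt mulNr expRN -ler_pV2 ?inE ?unitfE ?gt_eqF ?invr_gt0 ?expR_gt0//.
rewrite invrK (le_trans _ (expR_ge1Dx _))// /c /t.
rewrite le_eqVlt; apply/orP; left; apply/eqP.
field; rewrite !gt_eqF//= subr_gt0//.
Qed.

End blowup.

(** Away from 0 the power is differentiable; at 0 the bound |z|^p <= |z| for |z| <= 1 suffices,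
    which uses 1 <= p. *)
Lemma powR_norm_continuous (R : realType) (p : R) : 1 <= p ->
  continuous (fun y : R => `|y| `^ p).
Proof.
move=> p1; move=> /= y; have [->|y0] := eqVneq y 0; last first.
  have ny0 : 0 < `|y| by rewrite normr_gt0.
  exact: (continuous_cvg (nbhs_filter y) (@powR_continuous_gt0 R p _ ny0)
    (@norm_continuous _ _ y)).
have pn0 : p != 0 by rewrite gt_eqF// (lt_le_trans ltr01).
rewrite /continuous_at normr0 powR0//; apply/cvgrPdist_le => e e0.
near=> z; rewrite sub0r normrN norm_powR// normr_id.
have [->|z0] := eqVneq z 0; first by rewrite normr0 powR0// ltW.
have z1 : `|z| <= 1.
  by near: z; exact: (@nbhs0_le R R).
have ze : `|z| <= e.
  by near: z; exact: (@nbhs0_le R R).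
by rewrite (le_trans _ ze)// ge1r_powR// normr_gt0 z0.
Unshelve. all: by end_near. Qed.

(** * Splitting the Laplacian, and order properties of the reaction term *)

Section reaction.
Context {R : realType} {V : choiceType}.
Variable G : weighted_graph R V.
Hypothesis lf : locally_finite G.

Definition degree x : R :=
  (mass G x)^-1 * \sum_(y \in neighbours G x) weight G x y.

(** Not a normalised mean: the coefficients sum to [degree x], not to 1. This is the off-diagonal
    part of the Laplacian, the part that preserves order. *)
Definition averaging (f : V -> R) x : R :=
  (mass G x)^-1 * \sum_(y \in neighbours G x) weight G x y * f y.

(** Local finiteness turns the sums over [neighbours] into ordinary finite sums, free of the default
    value 0, so they can be split. *)
Lemma laplacianE f x : laplacian G f x = averaging f x - degree x * f x.
Proof.
rewrite /laplacian /averaging /degree !fsbig_finite//=.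
rewrite -mulrA -mulrBr mulr_suml -sumrB.
by congr (_ * _); apply: eq_bigr => y _; rewrite mulrBr.
Qed.

Lemma degree_ge0 x : 0 <= degree x.
Proof.
rewrite mulr_ge0 ?invr_ge0 ?(ltW (mass_gt0 G x))// fsbig_finite//=.
by apply: sumr_ge0 => y _; exact: weight_ge0.
Qed.

Lemma averaging_cst c x : averaging (fun=> c) x = degree x * c.
Proof. by rewrite /averaging /degree !fsbig_finite//= -mulrA mulr_suml. Qed.

Lemma averaging_le f g x : (forall y, f y <= g y) ->
  averaging f x <= averaging g x.
Proof.
move=> fg; rewrite ler_wpM2l ?invr_ge0 ?(ltW (mass_gt0 G x))//.
rewrite !fsbig_finite//=.
by apply: ler_sum => y _; rewrite ler_wpM2l// weight_ge0.
Qed.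

Lemma averaging_ge0 f x : (forall y, 0 <= f y) -> 0 <= averaging f x.
Proof. by move=> f0; rewrite (le_trans _ (averaging_le x f0))// averaging_cst mulr0. Qed.

(** The scalar blow-up estimate is applied to [u x] at a single vertex. The [+ 1] in [D] makes it
    positive even at a vertex of degree zero. *)
Lemma life_span_le (p : R) (u0 : V -> R) (x : V) (D := degree x + 1) :
  1 < p -> 0 < u0 x -> D * u0 x `^ (1 - p) < 1 ->
  (life_span G p u0 <=
    (u0 x `^ (1 - p) / ((p - 1) * (1 - D * u0 x `^ (1 - p))))%:E)%E.
Proof.
move=> p1 u0x Du; apply: ge_ereal_sup => _ [T [T0 [u us]] <-].
rewrite lee_fin -(sol_init us); apply: blowup_time => //.
- by rewrite ltr_wpDl ?degree_ge0.
- exact: (sol_continuous us).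
- exact: (sol_derivable us).
- move=> t tT; have tT' : 0 <= t < T by case/andP: tT => /ltW -> ->.
  rewrite (sol_eq us)// laplacianE /D mulrDl mul1r.
  have := averaging_ge0 x (fun y => sol_ge0 us y tT'); have := sol_ge0 us x tT'.
  lra.
- by rewrite (sol_init us).
- by rewrite (sol_init us).
Qed.

Variable p : R.
Hypothesis p1 : 1 < p.

(* The absolute value makes this continuous in [f] without a sign condition. *)
Definition reaction (f : V -> R) x : R := averaging f x + `|f x| `^ p.

(** The sum is finite, so convergence at each vertex is enough. The filter is left general to serve
    both continuity in time and the limit of the Picard iterates. *)
Lemma reaction_cvg (T : Type) (F : set_system T) (f : V -> T -> R) (g : V -> R) x :
  Filter F -> (forall y, f y @ F --> g y) ->
  reaction (fun y => f y i) x @[i --> F] --> reaction g x.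
Proof.
move=> FF fg; apply: cvgD.
  rewrite /averaging; apply: cvgMr.
  rewrite [X in _ --> X]fsbig_finite//=.
  under eq_fun do rewrite fsbig_finite//=.
  apply: cvg_big => [|y _]; first exact: add_continuous.
  by apply: cvgMr; exact: fg.
apply: (@continuous_cvg _ _ _ F FF (f x) (fun y => `|y| `^ p) (g x)); last exact: fg.
by apply: powR_norm_continuous; exact: ltW.
Qed.

Lemma reaction_le f g x : (forall y, 0 <= f y <= g y) -> reaction f x <= reaction g x.
Proof.
move=> fg; apply: lerD; first by apply: averaging_le => y; case/andP: (fg y).
have /andP[f0 fgx] := fg x.
apply: ge0_ler_powR; rewrite ?nnegrE//; first by rewrite ltW// (lt_trans ltr01).
by rewrite !ger0_norm// (le_trans f0).
Qed.

Lemma reaction_ge0 f x : (forall y, 0 <= f y) -> 0 <= reaction f x.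
Proof. by move=> f0; rewrite addr_ge0 ?averaging_ge0 ?powR_ge0. Qed.

End reaction.

(** * The spatially constant supersolution *)

Section barrier.
Context {R : realType}.
Variables p N b : R.
Hypotheses (p1 : 1 < p) (N0 : 0 < N).
Hypothesis bN : (p - 1) * b < N `^ (1 - p).

(* The solution of z' = z^p, z 0 = N, which blows up at N^(1-p)/(p-1). *)
Definition barrier (t : R) : R :=
  (N `^ (1 - p) - (p - 1) * t) `^ (- (p - 1)^-1).

(** [bN] places [b] strictly before the blow-up time, so the power is always taken of a positive
    base. *)
Lemma barrier_base_gt0 t : t <= b -> 0 < N `^ (1 - p) - (p - 1) * t.
Proof.
by move=> tb; rewrite subr_gt0 (le_lt_trans _ bN)// ler_wpM2l// subr_ge0 ltW.
Qed.

Lemma barrier_gt0 t : t <= b -> 0 < barrier t.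
Proof. by move=> tb; rewrite powR_gt0// barrier_base_gt0. Qed.

Lemma barrier0 : barrier 0 = N.
Proof.
rewrite /barrier mulr0 subr0 -powRrM.
have -> : (1 - p) * - (p - 1)^-1 = 1 by field; rewrite subr_eq0 gt_eqF.
by rewrite powRr1// ltW.
Qed.

Lemma is_derive_barrier t : t <= b -> is_derive t 1 barrier (barrier t `^ p).
Proof.
move=> tb.
have H1 := is_deriveZ (p - 1) (is_derive_id t (1 : R)).
have H2 := is_deriveB (is_derive_cst (N `^ (1 - p)) t (1 : R)) H1.
have H3 := is_derive1_powR (- (p - 1)^-1) (barrier_base_gt0 tb).
have := @is_derive1_comp R (fun y => y `^ (- (p - 1)^-1)) _ t _ _ H3 H2.
have p10 : p - 1 != 0 by rewrite subr_eq0 gt_eqF.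
rewrite /barrier -powRrM.
(* This equality of exponents is what makes z' equal to z^p. *)
have -> : - (p - 1)^-1 * p = - (p - 1)^-1 - 1 by field.
rewrite [X in is_derive _ _ _ X -> _](_ : _ =
  (N `^ (1 - p) - (p - 1) * t) `^ (- (p - 1)^-1 - 1))//.
by rewrite /GRing.scale/=; field.
Qed.

Lemma barrier_continuous : {within `[0, b], continuous barrier}.
Proof.
apply: continuous_in_subspaceT => t /[!inE]/=; rewrite in_itv/= => /andP[_ tb].
by apply/differentiable_continuous/derivable1_diffP; have [] := is_derive_barrier tb.
Qed.

Lemma barrier_le s t : 0 <= s -> s <= t -> t <= b -> barrier s <= barrier t.
Proof.
move=> s0 st tb; apply: (@ger0_derive1_le_cc _ barrier 0 b) => //.
- by move=> r; rewrite in_itv/= => /andP[_ /ltW rb]; have [] := is_derive_barrier rb.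
- move=> r; rewrite in_itv/= => /andP[_ /ltW rb].
  by rewrite derive1E; have [_ ->] := is_derive_barrier rb; exact: powR_ge0.
- exact: barrier_continuous.
- by rewrite in_itv/= s0 (le_trans st).
- by rewrite in_itv/= tb (le_trans s0).
Qed.

End barrier.

(** * The variation-of-constants operator *)

Section duhamel.
Context {R : realType} {V : choiceType}.
Variables (G : weighted_graph R V) (p : R) (u0 : V -> R) (b : R).
Hypotheses (lf : locally_finite G) (p1 : 1 < p) (b0 : 0 < b).
Notation mu := (@lebesgue_measure R).

Definition forcing (u : V -> R -> R) x s : R :=
  expR (degree G x * s) * reaction G p (u^~ s) x.

(* Variation of constants for u_x' = - degree x * u_x + reaction u x. *)
Definition duhamel (u : V -> R -> R) x t : R :=
  expR (- degree G x * t) * (u0 x + \int[mu]_(s in `[0, t]) forcing u x s).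

Definition continuous_paths (u : V -> R -> R) : Prop :=
  forall x, {within `[0, b], continuous (u x)}.

Lemma forcing_continuous u x : continuous_paths u ->
  {within `[0, b], continuous (forcing u x)}.
Proof.
move=> cu; apply: within_continuousM.
  by apply: continuous_subspaceT; exact: continuous_expRM.
by move=> s; apply: reaction_cvg => // y; exact: cu.
Qed.

Lemma forcing_integrable u x t : continuous_paths u -> t <= b ->
  mu.-integrable `[0, t] (EFin \o forcing u x).
Proof.
move=> cu tb; apply: continuous_compact_integrable; first exact: segment_compact.
apply/(continuous_subspaceW _ (@forcing_continuous u x cu))/subset_itvl.
by rewrite bnd_simp.
Qed.

(** Only integrability is assumed: the limit of the Picard iterates is not yet known to be
    continuous when this is applied to it. *)
Lemma duhamel_continuous u :
  (forall x, mu.-integrable `[0, b] (EFin \o forcing u x)) ->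
  continuous_paths (duhamel u).
Proof.
move=> iu x; apply: within_continuousM.
  by apply: continuous_subspaceT; exact: continuous_expRM.
have := parameterized_integral_continuous (ltW b0) (iu x).
move=> c s; apply: cvgD; [exact: cvg_cst|exact: c].
Qed.

(** The negative diagonal term of the Laplacian sits in the exponential factors, so what remains
    under the integral preserves order on nonnegative functions. *)
Lemma duhamel_le u v x t :
  mu.-integrable `[0, t] (EFin \o forcing u x) ->
  mu.-integrable `[0, t] (EFin \o forcing v x) ->
  (forall y (s : R), 0 <= s <= t -> 0 <= u y s <= v y s) ->
  duhamel u x t <= duhamel v x t.
Proof.
move=> iu iv uv; rewrite ler_wpM2l ?expR_ge0// lerD2l.
apply: le_Rintegral => // s; rewrite /= in_itv/= => st.
by rewrite ler_wpM2l ?expR_ge0// reaction_le// => y; exact: uv.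
Qed.

Lemma duhamel_ge0 (u : V -> R -> R) x t : 0 <= u0 x ->
  (forall y (s : R), 0 <= s <= t -> 0 <= u y s) -> 0 <= duhamel u x t.
Proof.
move=> u00 u_ge0; rewrite mulr_ge0 ?expR_ge0// addr_ge0//.
apply: Rintegral_ge0 => s; rewrite /= in_itv/= => st.
by rewrite mulr_ge0 ?expR_ge0// reaction_ge0// => y; exact: u_ge0.
Qed.

Lemma duhamel0 u x : duhamel u x 0 = u0 x.
Proof. by rewrite /duhamel set_itv1 Rintegral_set1 addr0 mulr0 expR0 mul1r. Qed.

Lemma is_derive_duhamel u x t : 0 < t < b ->
  mu.-integrable `[0, b] (EFin \o forcing u x) -> {for t, continuous (forcing u x)} ->
  is_derive t 1 (duhamel u x) (reaction G p (u^~ t) x - degree G x * duhamel u x t).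
Proof.
move=> /andP[t0 tb] iu cu.
have [] := continuous_FTC1_closed tb iu t0 cu.
move=> /derivableP; rewrite -derive1E => + E; rewrite E => H1.
have H2 := is_deriveD (is_derive_cst (u0 x) t (1 : R)) H1.
have := is_deriveM (is_derive_expRM (- degree G x) t) H2.
rewrite [X in is_derive _ _ _ X -> _](_ : _ =
  reaction G p (u^~ t) x - degree G x * duhamel u x t)//.
have E2 : expR (- degree G x * t) * forcing u x t = reaction G p (u^~ t) x.
  by rewrite /forcing mulrA -expRD mulNr addNr expR0 mul1r.
rewrite -E2 /duhamel /GRing.scale/= add0r [X in _ + X * _](_ : _ =
  u0 x + \int[mu]_(s in `[0, t]) forcing u x s)//.
by ring.
Qed.

(** Bootstrap: an integrable forcing makes [duhamel u], hence [u], continuous; then the forcing is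
    continuous and the fundamental theorem of calculus differentiates [u]; the resulting formula for
    the derivative is continuous in turn. *)
Lemma duhamel_fixpoint_is_solution u Z :
  (forall x, mu.-integrable `[0, b] (EFin \o forcing u x)) ->
  (forall x (t : R), 0 <= t <= b -> u x t = duhamel u x t) ->
  (forall x (t : R), 0 <= t <= b -> 0 <= u x t <= Z) ->
  is_solution G p u0 b u.
Proof.
move=> iu uE uZ.
have cu : continuous_paths u.
  move=> x; have /(_ x) := @duhamel_continuous u iu; apply: subspace_eq_continuous.
  by move=> t; rewrite inE/= in_itv/= => /uE E; rewrite /from_subspace E.
have cf x (t : R) : 0 < t < b -> {for t, continuous (forcing u x)}.
  move=> tb; apply: within_continuous_continuous (@forcing_continuous u x cu) _ => //.
have near_itv (t : R) : 0 < t < b -> \near t, 0 < t < b.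
  move=> tb; have := @near_in_itvoo R 0 b t.
  by rewrite in_itv/= => /(_ tb).
(* The fixed-point identity is known on [0, b] only, so derivatives are transferred through a
   neighbourhood of an interior time. *)
have nearE x (t : R) : 0 < t < b -> \forall s \near t, duhamel u x s = u x s.
  move=> /near_itv; apply: filterS => s /andP[s0 sb].
  by rewrite -uE// ltW//= ltW.
have ud x (t : R) : 0 < t < b ->
    is_derive t 1 (u x) (reaction G p (u^~ t) x - degree G x * u x t).
  move=> tb; have tb' : 0 <= t <= b by case/andP: tb => /ltW -> /ltW.
  have := is_derive_duhamel tb (iu x) (cf x t tb).
  rewrite -uE// => -[d e]; split; first exact: near_eq_derivable (nearE x t tb) d.
  by rewrite -(near_eq_derive _ (nearE x t tb)).
have u_ge0 x (t : R) : 0 <= t < b -> 0 <= u x t.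
  by move=> /andP[t0 tb]; have /andP[] : 0 <= u x t <= Z by rewrite uZ// t0 ltW.
split=> //.
- by move=> x; apply/(continuous_subspaceW _ (cu x))/subset_itvl; rewrite bnd_simp.
- by move=> x t /ud -/(_ x)[].
- move=> x t tb.
  have E : \forall s \near t,
      reaction G p (u^~ s) x - degree G x * u x s = derive1 (u x) s.
    by move: (near_itv t tb); apply: filterS => s /ud -/(_ x)[_]; rewrite derive1E.
  rewrite /prop_for /continuous_at -(nbhs_singleton E).
  apply: cvg_trans (near_eq_cvg E) _.
  have cux y : u y @ t --> u y t.
    by apply: within_continuous_continuous (cu y) _ => //; rewrite in_itv/=.
  apply: cvgB; first exact: reaction_cvg.
  by apply: cvgMr.
- move=> x t tb; have [_] := ud x t tb; rewrite derive1E => ->.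
  have tb' : 0 <= t < b by case/andP: tb => /ltW ->.
  (* Nonnegativity of [u] removes the absolute value built into [reaction]. *)
  rewrite laplacianE// /reaction ger0_norm ?u_ge0//; ring.
- by move=> x; rewrite uE ?duhamel0// lexx ltW.
- move=> T' /andP[_ T'b]; exists Z => x t /andP[t0 tT'].
  have /andP[ut0 utZ] : 0 <= u x t <= Z.
    by rewrite uZ// t0 (le_trans tT')// ltW.
  by rewrite ger0_norm.
Qed.

End duhamel.

(** * Existence by monotone Picard iteration *)

Section existence.
Context {R : realType} {V : choiceType}.
Variables (G : weighted_graph R V) (p : R) (u0 : V -> R) (N b : R).
Hypotheses (lf : locally_finite G) (p1 : 1 < p).
Hypotheses (u0_ge0 : forall x, 0 <= u0 x) (u0_leN : forall x, u0 x <= N).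
Hypotheses (N0 : 0 < N) (b0 : 0 < b) (bN : (p - 1) * b < N `^ (1 - p)).
Notation mu := (@lebesgue_measure R).

(** Averaging a spatial constant multiplies it by the degree d, so the forcing of the barrier z is
    the derivative of e^(d s) z(s). Integrating exactly, the left side is z(t) + e^(-d t) (u0(x) -
    N), and u0(x) <= N. *)
Lemma duhamel_barrier_le x (t : R) : 0 <= t <= b ->
  duhamel G p u0 (fun=> barrier p N) x t <= barrier p N t.
Proof.
(* Time 0 is treated apart because the fundamental theorem needs a nondegenerate interval. *)
move=> /andP[]; rewrite le_eqVlt => /predU1P[<- _|t0 tb].
  by rewrite duhamel0 barrier0.
set d := degree G x.
pose F s := expR (d * s) * barrier p N s.
have cz : continuous_paths b (fun _ : V => barrier p N).
  by move=> _; exact: barrier_continuous.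
have subt : `[0, t] `<=` `[0, b] by apply: subset_itvl; rewrite bnd_simp.
have cf := continuous_subspaceW subt (@forcing_continuous R V G p b lf p1 _ x cz).
have F' s : s < t -> is_derive s 1 F (forcing G p (fun=> barrier p N) x s).
  move=> /ltW st; have sb := le_trans st tb.
  have := is_deriveM (is_derive_expRM d s) (is_derive_barrier p1 bN sb).
  rewrite /forcing /reaction averaging_cst// gtr0_norm ?(barrier_gt0 p1 bN)//.
  rewrite /GRing.scale/= -/d.
  by rewrite [X in is_derive _ _ _ X -> _](_ : _ =
    expR (d * s) * (d * barrier p N s + barrier p N s `^ p))//; ring.
have cF : {within `[0, t], continuous F}.
  apply: within_continuousM; last exact: continuous_subspaceW subt (cz x).
  by apply: continuous_subspaceT; exact: continuous_expRM.
have /(continuous_within_itvP _ t0)[_ Fl Fr] := cF.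
have := @continuous_FTC2 _ _ F _ _ t0 cf.
rewrite /duhamel -/d /Rintegral => ->; last 2 first.
  split=> // s; rewrite in_itv/= => /andP[_ st].
  by have [] := F' s st.
  move=> s; rewrite in_itv/= => /andP[_ st].
  by rewrite derive1E; have [_ ->] := F' s st.
rewrite /F/= mulr0 expR0 mul1r barrier0// addrCA mulrDr mulrA -expRD.
rewrite mulNr addNr expR0 mul1r gerDl.
by rewrite mulr_ge0_le0 ?expR_ge0// subr_le0.
Qed.

Definition picard n : V -> R -> R := iter n (duhamel G p u0) (fun _ => cst 0).

Lemma picardS n : picard n.+1 = duhamel G p u0 (picard n).
Proof. by []. Qed.

Lemma picard_continuous n : continuous_paths b (picard n).
Proof.
elim: n => [|n IHn]; first by move=> x; apply: continuous_subspaceT; exact: cst_continuous.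
by apply: duhamel_continuous => // x; exact: (forcing_integrable lf p1 x IHn (lexx b)).
Qed.

(** By induction: the operator preserves nonnegativity and order, and sends the barrier below
    itself. *)
Lemma picard_bounds n x (t : R) : 0 <= t <= b ->
  0 <= picard n x t <= barrier p N t.
Proof.
elim: n x t => [|n IHn] x t tb.
  by rewrite lexx ltW// (barrier_gt0 p1 bN)//; case/andP: tb.
have IHn' y (s : R) : 0 <= s <= t -> 0 <= picard n y s <= barrier p N s.
  by move=> /andP[s0 st]; apply: IHn; rewrite s0 (le_trans st)//; case/andP: tb.
apply/andP; split.
  by rewrite picardS; apply: duhamel_ge0 => // y s st; have /andP[] := IHn' y s st.
rewrite picardS; apply: le_trans (duhamel_barrier_le x tb); case/andP: tb => t0 tb.
apply: (duhamel_le u0 lf p1) => //; apply: (forcing_integrable lf p1 x _ tb) => //.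
  exact: picard_continuous.
by move=> _; exact: barrier_continuous.
Qed.

(** The first comparison is nonnegativity of the first iterate, since the iteration starts at 0;
    monotonicity of the operator propagates it. *)
Lemma picard_le n x (t : R) : 0 <= t <= b -> picard n x t <= picard n.+1 x t.
Proof.
elim: n x t => [|n IHn] x t tb; first by have /andP[] := picard_bounds 1 x tb.
case/andP: tb => t0 tb; rewrite (picardS n) (picardS n.+1); apply: (duhamel_le u0 lf p1) => //.
- by apply: (forcing_integrable lf p1 x _ tb) => //; exact: picard_continuous.
- by apply: (forcing_integrable lf p1 x _ tb) => //; exact: picard_continuous.
- move=> y s /andP[s0 st]; have sb : 0 <= s <= b by rewrite s0 (le_trans st).
  by rewrite IHn// andbT; have /andP[] := picard_bounds n y sb.
Qed.

(** Meaningful on [0, b] only, where the iterates are shown to converge. *)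
Definition picard_lim x t : R := limn (fun n => picard n x t).

Lemma picard_cvg x (t : R) : 0 <= t <= b ->
  picard n x t @[n --> \oo] --> picard_lim x t.
Proof.
move=> tb; apply: nondecreasing_is_cvgn.
  by apply/nondecreasing_seqP => n; exact: picard_le.
by exists (barrier p N t) => _ [n _ <-]; have /andP[] := picard_bounds n x tb.
Qed.

Lemma picard_lim_bounds x (t : R) : 0 <= t <= b ->
  0 <= picard_lim x t <= barrier p N t.
Proof.
move=> tb; have c := (@picard_cvg x t tb); apply/andP; split.
- apply: limr_ge; [exact: c|apply: nearW] => n.
  by have /andP[] := picard_bounds n x tb.
- apply: limr_le; [exact: c|apply: nearW] => n.
  by have /andP[] := picard_bounds n x tb.
Qed.

(** Dominated convergence, with the forcing of the barrier as dominating function. Measurability of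
    the limit comes from pointwise convergence. *)
Lemma forcing_picard_lim x (t : R) : 0 <= t <= b ->
  mu.-integrable `[0, t] (EFin \o forcing G p picard_lim x) /\
  \int[mu]_(s in `[0, t]) forcing G p (picard n) x s @[n --> \oo] -->
    \int[mu]_(s in `[0, t]) forcing G p picard_lim x s.
Proof.
move=> /andP[t0 tb].
have subt s : `[0, t]%classic s -> 0 <= s <= b.
  by rewrite /= in_itv/= => /andP[-> st]; rewrite (le_trans st).
have fi n := @forcing_integrable R V G p b lf p1 _ x t (@picard_continuous n) tb.
have zi : mu.-integrable `[0, t] (EFin \o forcing G p (fun=> barrier p N) x).
  by apply: (forcing_integrable lf p1 x _ tb) => // _; exact: barrier_continuous.
have fcvg s : `[0, t]%classic s ->
    (forcing G p (picard n) x s)%:E @[n --> \oo] --> (forcing G p picard_lim x s)%:E.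
  move=> /subt sb; apply: cvg_EFin; first exact: nearW.
  by apply: cvgMr; apply: reaction_cvg => // y; exact: picard_cvg.
have fm n := measurable_int _ (fi n).
have limm := measurable_realfun.emeasurable_fun_cvg _
  (EFin \o forcing G p picard_lim x) fm fcvg.
have [||limi _ lim] := @dominated_convergence _ _ R mu _ (measurable_itv `[0, t])
  _ _ _ fm limm _ zi.
- by apply: aeW => s; exact: fcvg.
- apply: aeW => s n /subt sb; rewrite /= lee_fin ger0_norm.
    rewrite ler_wpM2l ?expR_ge0// reaction_le// => y; exact: picard_bounds.
  rewrite mulr_ge0 ?expR_ge0// reaction_ge0// => y.
  by have /andP[] := picard_bounds n y sb.
split=> //; apply: fine_cvg.
rewrite /Rintegral fineK//; exact: integrable_fin_num.
Qed.

Lemma picard_lim_fixpoint x (t : R) : 0 <= t <= b ->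
  picard_lim x t = duhamel G p u0 picard_lim x t.
Proof.
move=> tb; have [_ fl] := forcing_picard_lim x tb.
(* The shifted sequence has the same limit, and its terms are the operator applied to the
   iterates. *)
have := (@picard_cvg x t tb); rewrite -(cvg_shiftS (fun n => picard n x t)) => c.
apply: (cvg_unique _ c) => //=; apply: cvgMr.
by apply: cvgD; [exact: cvg_cst|exact: fl].
Qed.

Lemma exists_solution : exists u, is_solution G p u0 b u.
Proof.
have bb : 0 <= b <= b by rewrite lexx ltW.
exists picard_lim.
apply: (@duhamel_fixpoint_is_solution _ _ _ _ _ _ lf p1 b0 _ (barrier p N b)).
- by move=> x; have [] := forcing_picard_lim x bb.
- exact: picard_lim_fixpoint.
- move=> x t tb; have /andP[-> /le_trans ->]// := picard_lim_bounds x tb.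
  by case/andP: tb => t0 tb; apply: (barrier_le p1 bN).
Qed.

End existence.

(** * Bounds on the life span and the limit for large data *)

Lemma life_span_ge (R : realType) (V : choiceType) (G : weighted_graph R V)
    (p : R) (u0 : V -> R) (N : R) :
  locally_finite G -> 1 < p -> (forall x, 0 <= u0 x <= N) -> 0 < N ->
  ((N `^ (1 - p) / (p - 1))%:E <= life_span G p u0)%E.
Proof.
move=> lf p1 u0N N0; set T0 := N `^ (1 - p) / (p - 1).
have p10 : 0 < p - 1 by rewrite subr_gt0.
have T00 : 0 < T0 by rewrite divr_gt0// powR_gt0.
have ge (b : R) : 0 < b -> b < T0 -> (b%:E <= life_span G p u0)%E.
  move=> b0 bT0; apply: ereal_sup_ubound; exists b => //; split=> //.
  apply: (exists_solution (N := N)) => //.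
  - by move=> x; have /andP[] := u0N x.
  - by move=> x; have /andP[] := u0N x.
  - by rewrite mulrC -ltr_pdivlMr.
rewrite leNgt; apply/negP => lt.
(* This excludes the value -oo and makes L positive, so that the midpoint of L and T0 is an
   admissible time exceeding L. *)
have h2 : ((T0 / 2)%:E <= life_span G p u0)%E by apply: ge; lra.
move: lt h2 ge; case: (life_span _ _ _) => [L| |]//.
rewrite lte_fin lee_fin => LT TL /(_ ((L + T0) / 2)).
by rewrite lee_fin; lra.
Qed.

(** After multiplication by lambda^(p-1), the blow-up bound reads A / ((p-1)(1 - D w)), where w
    tends to 0 as lambda grows. It is at most [eta] once D w <= 1 - A / B. *)
Lemma life_span_asymptotic_le (R : realType) (V : choiceType)
    (G : weighted_graph R V) (p : R) (psi : V -> R) (x : V) (eta : R) :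
  locally_finite G -> 1 < p -> 0 < psi x -> psi x `^ (1 - p) < (p - 1) * eta ->
  exists2 Lambda : R, 0 < Lambda & forall lambda : R, Lambda < lambda ->
    ((lambda `^ (p - 1))%:E * life_span G p (fun x => (lambda * psi x)%R) <=
      eta%:E)%E.
Proof.
move=> lf p1 psix A_lt.
have p10 : 0 < p - 1 by rewrite subr_gt0.
set A := psi x `^ (1 - p) in A_lt *.
have A0 : 0 < A by rewrite powR_gt0.
have B0 : 0 < (p - 1) * eta by exact: lt_trans A_lt.
set B := (p - 1) * eta in A_lt B0.
pose D := degree G x + 1.
have D0 : 0 < D by rewrite ltr_wpDl ?degree_ge0.
(* [delta] is the threshold on w for this; [Lambda] below is the value of lambda at which w equals
   [delta]. *)
pose delta := (1 - A / B) / D.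
have delta0 : 0 < delta by rewrite divr_gt0// subr_gt0 ltr_pdivrMr// mul1r.
exists (delta `^ (- (p - 1)^-1) / psi x); first by rewrite divr_gt0// powR_gt0.
move=> lambda; rewrite ltr_pdivrMr// => lt.
have lp0 : 0 < lambda * psi x by apply: lt_trans lt; rewrite powR_gt0.
have l0 : 0 < lambda by rewrite pmulr_lgt0 in lp0.
set w := (lambda * psi x) `^ (1 - p).
have wA : lambda `^ (p - 1) * w = A.
  rewrite /w powRM ?ltW// mulrA -powRD ?(gt_eqF l0) ?implybT//.
  by rewrite (_ : p - 1 + (1 - p) = 0) ?powRr0 ?mul1r//; ring.
have wd : w < delta.
  have : (delta `^ (- (p - 1)^-1)) `^ (p - 1) < (lambda * psi x) `^ (p - 1).
    by rewrite gt0_ltr_powR// nnegrE ltW// powR_gt0.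
  rewrite -powRrM mulNr mulVf ?gt_eqF// powR_inv1 ?ltW//.
  rewrite /w (_ : 1 - p = - (p - 1)); last by ring.
  by rewrite powRN => h; rewrite invf_plt// posrE powR_gt0.
have Dw : D * w < 1 - A / B by rewrite mulrC -ltr_pdivlMr.
have Dw1 : D * w < 1 by apply: lt_trans Dw _; rewrite gtrBl divr_gt0.
have := @life_span_le _ _ G lf p (fun x => lambda * psi x) x p1 lp0 Dw1.
move=> le; apply: (@le_trans _ _ ((lambda `^ (p - 1))%:E *
    (w / ((p - 1) * (1 - D * w)))%:E)%E).
  by rewrite lee_pmul2l// lte_fin powR_gt0.
rewrite -EFinM lee_fin mulrA wA ler_pdivrMr ?mulr_gt0 ?subr_gt0//.
rewrite mulrA [eta * _]mulrC -/B.
have : B * (A / B) <= B * (1 - D * w) by rewrite ler_pM2l//; lra.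
by rewrite mulrC divfK// gt_eqF.
Qed.

Theorem theorem1p1 (R : realType) (V : choiceType) (G : weighted_graph R V)
    (p : R) (psi : V -> R)
    (V_infinite : infinite_set [set: V])
    (G_locally_finite : locally_finite G)
    (G_connected : connected_graph G)
    (omega_min_gt0 : (0 < omega_min G)%E)
    (p_gt1 : 1 < p)
    (psi_ge0 : forall x, 0 <= psi x)
    (psi_bounded : exists M : R, forall x, psi x <= M)
    (psi_neq0 : exists x, psi x != 0)
    (Dmu_finite : (Dmu G < +oo)%E) :
  (exists2 Lambda : R, 0 < Lambda &
    forall lambda : R, Lambda < lambda ->
      (life_span G p (fun x => (lambda * psi x)%R) < +oo)%E) /\
  ((lambda `^ (p - 1))%R%:E * life_span G p (fun x => (lambda * psi x)%R))%E
    @[lambda --> +oo%R] -->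
    (((p - 1) * linfty_norm psi `^ (p - 1))^-1)%:E.
Proof.
have p10 : 0 < p - 1 by rewrite subr_gt0.
set M := linfty_norm psi; set L := ((p - 1) * M `^ (p - 1))^-1.
have [x0 psix0] := psi_neq0.
(* Boundedness makes the norm a true supremum rather than a default value. *)
have hub : has_ubound [set `|psi x| | x in [set: V]].
  by have [C psiC] := psi_bounded; exists C => _ [x _ <-]; rewrite ger0_norm.
have psi_leM x : psi x <= M.
  by rewrite -[psi x]ger0_norm//; apply: ub_le_sup => //; exists x.
have M0 : 0 < M by rewrite (lt_le_trans _ (psi_leM x0))// lt0r psix0 psi_ge0.
have LE : L = M `^ (1 - p) / (p - 1).
  by rewrite /L invfM mulrC -powRN opprB.
(* With N = lambda M the powers of lambda cancel, so the bound holds for every positive lambda. *)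
have lower (lambda : R) : 0 < lambda ->
    (L%:E <= (lambda `^ (p - 1))%:E * life_span G p (fun x => (lambda * psi x)%R))%E.
  move=> l0; have lM0 : 0 < lambda * M by rewrite mulr_gt0.
  have := @life_span_ge R V G p (fun x => lambda * psi x) _ G_locally_finite
    p_gt1 _ lM0.
  have u0N x : 0 <= lambda * psi x <= lambda * M.
    by rewrite mulr_ge0 ?(ltW l0)//= ler_pM2l.
  move=> /(_ u0N) le.
  apply: (@le_trans _ _ ((lambda `^ (p - 1))%:E *
      ((lambda * M) `^ (1 - p) / (p - 1))%:E)%E); last first.
    by rewrite lee_pmul2l// lte_fin powR_gt0.
  rewrite -EFinM lee_fin LE powRM ?(ltW l0) ?(ltW M0)// !mulrA -powRD ?(gt_eqF l0) ?implybT//.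
  by rewrite (_ : p - 1 + (1 - p) = 0) ?powRr0 ?mul1r//; ring.
have upper (eta : R) : L < eta ->
    exists2 Lambda : R, 0 < Lambda & forall lambda : R, Lambda < lambda ->
    ((lambda `^ (p - 1))%:E * life_span G p (fun x => (lambda * psi x)%R) <=
      eta%:E)%E.
  rewrite LE ltr_pdivrMr// [eta * _]mulrC => MB.
  set B := (p - 1) * eta in MB.
  have B0 : 0 < B by apply: lt_trans MB; rewrite powR_gt0.
  (* [c] solves c^(1-p) = (p-1) eta. As s^(1-p) is decreasing, L < eta means c < M, so some vertex
     has psi(x) > c. *)
  pose c := B `^ (- (p - 1)^-1).
  have c0 : 0 < c by rewrite powR_gt0.
  have cB : c `^ (1 - p) = B.
    rewrite /c -powRrM (_ : - (p - 1)^-1 * (1 - p) = 1) ?powRr1 ?ltW//.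
    by field; rewrite gt_eqF.
  have powN_lt (y z : R) : 0 < y -> 0 < z -> y `^ (1 - p) < z `^ (1 - p) -> z < y.
    move=> y0 z0; apply: contraTT; rewrite -!leNgt => yz.
    rewrite -opprB !powRN lef_pV2 ?posrE ?powR_gt0//.
    by apply: ge0_ler_powR; rewrite ?nnegrE ?(ltW p10) ?(ltW y0) ?(ltW z0).
  have cM : c < M by apply: powN_lt => //; rewrite cB.
  have [||_ [x _ <-]] := @sup_gt R [set `|psi x| | x in [set: V]] c.
  - by exists `|psi x0|, x0.
  - exact: cM.
  rewrite ger0_norm// => cx.
  have psix : 0 < psi x by exact: lt_trans cx.
  apply: (@life_span_asymptotic_le R V G p psi x) => //.
  rewrite -/B -cB -opprB !powRN ltf_pV2 ?posrE ?powR_gt0//.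
  by apply: gt0_ltr_powR; rewrite ?nnegrE// ltW.
split.
  (* Any number above L would do: a finite bound on the product with a positive factor forces a
     finite life span. *)
  have [|Lambda L0 h] := upper (L + 1); first by rewrite ltrDl.
  exists Lambda => // lambda lt; have l0 := lt_trans L0 lt.
  have := h lambda lt; case: (life_span _ _ _) => [r _| |_] //.
    exact: ltry.
  by rewrite gt0_muley// lte_fin powR_gt0.
have near_bounds (e : R) : 0 < e -> \forall lambda \near +oo,
    (L%:E <= (lambda `^ (p - 1))%:E * life_span G p (fun x => (lambda * psi x)%R)
      <= (L + e)%:E)%E.
  move=> e0; have [|Lambda L0 h] := upper (L + e); first by rewrite ltrDl.
  near=> lambda.
  have lt : Lambda < lambda by near: lambda; apply: nbhs_pinfty_gt; exact: num_real.
  by rewrite h// lower// (lt_trans L0).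
(* Convergence to a finite limit in the extended reals: the product is eventually finite, and its
   real values converge by squeezing. *)
apply/fine_cvgP; split.
  apply: filterS (near_bounds 1 ltr01) => lambda /andP[le1 le2].
  by rewrite fin_numE -ltey -ltNye (lt_le_trans _ le1) ?ltNyr// (le_lt_trans le2) ?ltry.
apply/cvgrPdist_le => e e0.
apply: filterS (near_bounds e e0) => lambda /=.
case: (_ * _)%E => [r|/andP[_]|]//.
by rewrite !lee_fin /= => /andP[Lr re]; rewrite ler_distlC; apply/andP; split; lra.
Unshelve. all: by end_near. Qed.
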